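(* Suppose that $(\mathbf{X},\mathbf{Y})$ is good and $\mathbf{Y}$ is ergodic of zero entropy rate. If additionally $$\mathbb{P}(R_1=k)>0\ \text{ for infinitely many }k\in\mathbb{N}$$ and $\mathbf{X}$ is not bilaterally deterministic, then $\mathbf{H}(\mathbf{M})<\mathbf{H}(\mathbf{X})$, where $\mathbf{M}=\mathbf{X}\cdot\mathbf{Y}=(X_iY_i)_{i\in\mathbb{Z}}$.
   Context: All processes are bilateral (indexed by $\mathbb{Z}$), real-valued and defined on a probability space $(\Omega,\mathcal{F},\mathbb{P})$. The pair $(\mathbf{X},\mathbf{Y})$, $\mathbf{X}=(X_i)_{i\in\mathbb{Z}}$, $\mathbf{Y}=(Y_i)_{i\in\mathbb{Z}}$, is called good if: $\mathbf{X}$ and $\mathbf{Y}$ are stationary; $\mathbf{X}$ takes values in a finite set; $Y_i\in\{0,1\}$ and $\mathbb{P}(Y_0=1)>0$; $\mathbf{X}$ and $\mathbf{Y}$ are independent; and the return process $\mathbf{R}$ below is well defined almost surely, i.e. almost surely $Y_i=1$ for infinitely many $i\ge 0$ and infinitely many $i\le 0$. The return process $\mathbf{R}=(R_i)_{i\in\mathbb{Z}}$ is $R_0=\inf\{j\ge 0: Y_j=1\}$, $R_i=\inf\{j>R_{i-1}:Y_j=1\}$ for $i\ge1$, $R_i=\sup\{j<R_{i+1}:Y_j=1\}$ for $i\le -1$. For a stationary finitely-valued process $\mathbf{Z}$, $\mathbf{H}(\mathbf{Z})=\lim_n\frac1n\mathbf{H}(Z_0,\ldots,Z_{n-1})$ is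 its entropy rate ($\mathbf{H}$ of a finitely-valued random variable being Shannon entropy). A stationary finitely-valued process $\mathbf{Z}$ is bilaterally deterministic if for all $k\in\mathbb{N}$ $$\mathbf{H}\big(Z_{[0,k]}\mid Z_{(-\infty,-1]},Z_{[k+1,\infty)}\big)=0,$$ where $Z_A=(Z_i)_{i\in A}$, intervals are integer intervals, and conditional entropy is taken given the generated $\sigma$-algebra. *)

(* Defs.v *)
From HB Require Import structures.
From mathcomp Require Import all_boot all_order all_algebra.
From mathcomp Require Import all_classical all_reals all_analysis.

Set Implicit Arguments.
Unset Strict Implicit.
Unset Printing Implicit Defensive.

Import Order.TTheory GRing.Theory Num.Theory.
Import numFieldNormedType.Exports.

Local Open Scope classical_set_scope.
Local Open Scope ring_scope.

Section Paths.
Context {R : realType}.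

(* The sigma-algebra generated by the maps [Z i], [i \in I]. *)
Definition sigma_gen {U : Type} (Z : int -> U -> R) (I : set int) :
    set (set U) :=
  <<s \bigcup_(i in I) preimage_set_system setT (Z i) measurable >>.

Definition path_measurable : set (set (int -> R)) :=
  sigma_gen (fun (i : int) (x : int -> R) => x i) setT.

Definition left_shift (x : int -> R) : int -> R := fun i => x (i + 1).

(* On the sets below, [infimum 0] and [supremum 0] are the minimum and the
   maximum when these exist. Otherwise they are 0, a junk value that is used
   only on paths for which the return process is not well defined. *)
Fixpoint return_pos (y : int -> R) (n : nat) : int :=
  match n with
  | 0%N => infimum 0 [set j : int | 0 <= j /\ y j = 1]
  | m.+1 => infimum 0 [set j : int | return_pos y m < j /\ y j = 1]
  end.

(* [return_neg y n] is the return time of index [- n.+1]. *)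
Fixpoint return_neg (y : int -> R) (n : nat) : int :=
  match n with
  | 0%N => supremum 0 [set j : int | j < return_pos y 0 /\ y j = 1]
  | m.+1 => supremum 0 [set j : int | j < return_neg y m /\ y j = 1]
  end.

Definition return_time (y : int -> R) (i : int) : int :=
  match i with
  | Posz n => return_pos y n
  | Negz n => return_neg y n
  end.

End Paths.

Section Entropy.
Context {d : measure_display} {T : measurableType d} {R : realType}.
Variable P : probability T R.

Definition eta (x : R) : R := - (x * ln x).

(* Meaningful for [f] of finite range. *)
Definition entropy {V : choiceType} (f : T -> V) : R :=
  \sum_(v \in range f) eta (fine (P (f @^-1` [set v]))).

(* [g] is a version of the conditional probability of [E] given the
   sub-sigma-algebra [G]. *)
Definition is_cond_prob (G : set (set T)) (E : set T) (g : T -> R) : Prop :=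
  [/\ forall B : set R, measurable B -> G (g @^-1` B),
      P.-integrable setT (EFin \o g) &
      forall A, G A -> (\int[P]_(w in A) (g w)%:E = P (A `&` E))%E].

Definition cond_prob (G : set (set T)) (E : set T) : T -> R :=
  xget (fun=> 0) [set g | is_cond_prob G E g].

(* Meaningful for [f] of finite range. Versions of a conditional probability
   are equal almost surely, so the choice made in [cond_prob] is immaterial. *)
Definition cond_entropy {V : choiceType} (f : T -> V) (G : set (set T)) :
    \bar R :=
  'E_P[fun w => \sum_(v \in range f) eta (cond_prob G (f @^-1` [set v]) w)].

End Entropy.

Section Processes.
Context {d : measure_display} {T : measurableType d} {R : realType}.
Variable P : probability T R.
Implicit Types X Y Z : int -> T -> R.

Definition is_process Z : Prop := forall i, measurable_fun setT (Z i).

Definition sample_path Z (w : T) : int -> R := fun i => Z i w.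

Definition word Z (n : nat) (w : T) : n.-tuple R :=
  [tuple Z (i : nat)%:Z w | i < n].

Definition entropy_rate Z : R :=
  limn (fun n : nat => (n%:R)^-1 * entropy P (word Z n)).

Definition stationary Z : Prop :=
  forall B, path_measurable B ->
    P [set w | B (left_shift (sample_path Z w))] =
    P [set w | B (sample_path Z w)].

Definition ergodic Z : Prop :=
  stationary Z /\
  forall B, path_measurable B -> left_shift @^-1` B = B ->
    P [set w | B (sample_path Z w)] = 0%E \/
    P [set w | B (sample_path Z w)] = 1%E.

Definition finitely_valued Z : Prop :=
  exists2 A : set R, finite_set A & forall i w, A (Z i w).

Definition indep_processes X Y : Prop :=
  forall A B, sigma_gen X setT A -> sigma_gen Y setT B ->
    P (A `&` B) = (P A * P B)%E.

Definition bilaterally_deterministic Z : Prop :=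
  forall k : nat,
    cond_entropy P (word Z k.+1)
      (sigma_gen Z [set i : int | i <= -1 \/ k.+1%:Z <= i]) = 0%E.

Record good X Y : Prop := Good {
  good_processX : is_process X ;
  good_processY : is_process Y ;
  good_stationaryX : stationary X ;
  good_stationaryY : stationary Y ;
  good_finiteX : finitely_valued X ;
  good_binaryY : forall i w, Y i w = 0 \/ Y i w = 1 ;
  good_positiveY : (0 < P [set w | Y 0%R w = 1%R])%E ;
  good_indep : indep_processes X Y ;
  good_return : {ae P, forall w,
    infinite_set [set i : int | 0 <= i /\ Y i w = 1] /\
    infinite_set [set i : int | i <= 0 /\ Y i w = 1]} }.

Definition mul_process X Y : int -> T -> R := fun i w => X i w * Y i w.

End Processes.

(* Main.v *)
Require Import Defs.
From mathcomp Require Import all_boot all_order all_algebra.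
From mathcomp Require Import all_classical all_reals all_analysis.
From mathcomp Require Import measurable_realfun ring lra zify.

Set Implicit Arguments.
Unset Strict Implicit.
Unset Printing Implicit Defensive.

Import Order.TTheory GRing.Theory Num.Theory.
Import numFieldNormedType.Exports.
Local Open Scope classical_set_scope.
Local Open Scope ring_scope.

(** Why the entropy drops. Write [H_n] for the entropy of a word of length [n].
  The word of [M = X Y] of length [n] is a function of the word of [Y] and of
  the letters of [X] at the times where [Y] is 1. As [X] and [Y] are
  independent, the chain rule gives
    [H_n(M) <= H_n(Y) + sum_y P(Y_[0,n) = y) H(letters of X where y is 1)]
  (lemma [mul_entropy_le]), and [H_n(Y)] is negligible against [n]. It remains
  to see that hiding the letters of [X] at the zeros of [Y] loses a positive
  amount of entropy per unit of time.

  Since [X] is not bilaterally deterministic, there are a length [L] and a word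
  [v] such that the occurrence of [v] at the times [0, ..., L - 1] is not
  determined by the other letters: a version [g] of its conditional probability
  lies in some [[e, 1 - e]] on an event [D] of positive probability
  ([cond_entropy_undecided]). Given any finite family of letters outside of the
  block, revealing the block then raises the entropy by at least
  [gap = e P(D) / 2] ([undecided_gap]). This finite estimate replaces the
  convergence of conditional entropies along growing families of letters: if an
  atom [A] of the finite family meets [D] with probability [a], both halves into
  which the event splits [A] have probability at least [e a], and splitting costs
  at least half of the smaller half ([etaD_gap]).

  Cut [[0, n)] into consecutive slots of length [L]. By stationarity of [X] the
  estimate holds for every slot, and revealing one after the other the slots on
  which [y] vanishes shows that hiding the letters at the zeros of [y] costs at
  least [gap] per such slot ([free_slots_gap]). By stationarity of [Y] the
  expected number of these slots is about [n / L] times the probability that [Y]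
  vanishes on [[0, L)] ([free_slot_mean]). This probability is positive, because
  [R_1] takes arbitrarily large values with positive probability, and before a
  late second success there is a long run of zeros ([zero_run]). After division
  by [n], a positive multiple of [1 / L] separates the two entropy rates; the
  rates are limits by Fekete's lemma ([subadditive_cvg], [rate_cvg]). *)

(** * Splitting costs for x |-> - x ln x *)

Section EtaTheory.
Context {R : realType}.
Implicit Types x y a : R.

Lemma eta0 : eta (0 : R) = 0.
Proof. by rewrite /eta mul0r oppr0. Qed.

Lemma etaM x y : 0 <= x -> 0 <= y -> eta (x * y) = x * eta y + y * eta x.
Proof.
rewrite le_eqVlt => /predU1P[<-|x0]; first by rewrite !(mul0r, eta0, mulr0, addr0).
rewrite le_eqVlt => /predU1P[<-|y0]; first by rewrite !(mulr0, eta0, mul0r, addr0).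
by rewrite /eta lnM ?posrE//; lra.
Qed.

Lemma etaD_le x y : 0 <= x -> 0 <= y -> eta (x + y) <= eta x + eta y.
Proof.
rewrite le_eqVlt => /predU1P[<-|x0]; first by rewrite eta0 !add0r.
rewrite le_eqVlt => /predU1P[<-|y0]; first by rewrite eta0 !addr0.
have lx : ln x <= ln (x + y) by rewrite ler_ln ?posrE ?addr_gt0//; lra.
have ly : ln y <= ln (x + y) by rewrite ler_ln ?posrE ?addr_gt0//; lra.
rewrite /eta; have := ler_wpM2l (ltW x0) lx; have := ler_wpM2l (ltW y0) ly; lra.
Qed.

Lemma eta_sum_le (I : Type) (r : seq I) (Q : pred I) (F : I -> R) :
  (forall i, 0 <= F i) -> eta (\sum_(i <- r | Q i) F i) <= \sum_(i <- r | Q i) eta (F i).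
Proof.
move=> F0; elim: r => [|i r IH]; first by rewrite !big_nil eta0.
rewrite !big_cons; case: ifP => // _.
apply: (le_trans (etaD_le _ _)); rewrite ?sumr_ge0//.
by rewrite lerD2l.
Qed.

(** The logarithm lies below its tangent at 1; this is evaluated at [y / x]. *)
Lemma mul_ln_le x y : 0 <= x -> 0 < y -> x * ln y + eta x <= y - x.
Proof.
rewrite le_eqVlt => /predU1P[<-|x0] y0; first by rewrite mul0r eta0; lra.
have h : ln (y / x) <= y / x - 1.
  rewrite -{1}(subrK 1 (y / x)) [_ + 1]addrC; apply: le_ln1Dx.
  by have := divr_gt0 y0 x0; lra.
move: h; rewrite ln_div ?posrE// => /(ler_wpM2l (ltW x0)).
have -> : x * (y / x - 1) = y - x by rewrite mulrBr mulr1 mulrC divfK ?gt_eqF.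
by rewrite /eta; lra.
Qed.

(** Splitting an atom into parts of mass [x <= y] gains at least
  [x * ln ((x + y) / x)], and [ln ((x + y) / x) >= 1 - x / (x + y) >= 1 / 2]. *)
Lemma etaD_gap x y a : 0 <= a -> a <= x -> a <= y ->
  eta (x + y) + a / 2 <= eta x + eta y.
Proof.
wlog : x y / x <= y => [W a0 ax ay|xy a0 ax ay].
  case/orP: (le_total x y) => h; first exact: W.
  by rewrite addrC (addrC (eta x)) addrC (addrC x); exact: W.
have : 0 <= x by lra.
rewrite le_eqVlt => /predU1P[x0|xp]; first by subst x; rewrite !add0r eta0; lra.
have yp : 0 < y by lra.
have sp : 0 < x + y by lra.
have ly : ln y <= ln (x + y) by rewrite ler_ln ?posrE//; lra.
have hx : 1 / 2 <= ln (x + y) - ln x.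
  rewrite -(ler_pM2r sp); have := mul_ln_le (ltW sp) xp; rewrite /eta; lra.
have := ler_wpM2l (ltW xp) hx; have := ler_wpM2l (ltW yp) ly.
by rewrite /eta; lra.
Qed.

End EtaTheory.

(** * Entropy of finite laws *)

Section LawEntropy.
Context {R : realType}.

Definition law_entropy (W : finType) (p : W -> R) : R := \sum_w eta (p w).

Definition image_law (W V : finType) (f : W -> V) (p : W -> R) : V -> R :=
  fun v => \sum_(w | f w == v) p w.

Lemma image_law_ge0 (W V : finType) (f : W -> V) p v :
  (forall w, 0 <= p w) -> 0 <= image_law f p v.
Proof. by move=> p0; apply: sumr_ge0. Qed.

Lemma image_law_sum (W V : finType) (f : W -> V) (p : W -> R) (F : V -> R) :
  \sum_v image_law f p v * F v = \sum_w p w * F (f w).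
Proof.
rewrite [RHS](partition_big f xpredT)//=; apply: eq_bigr => v _.
by rewrite mulr_suml; apply: eq_bigr => w /eqP ->.
Qed.

Lemma image_law_mass (W V : finType) (f : W -> V) (p : W -> R) :
  \sum_v image_law f p v = \sum_w p w.
Proof. by rewrite [RHS](partition_big f xpredT). Qed.

(** A function of a variable carries at most its entropy, because merging atoms
  only loses entropy. *)
Lemma law_entropy_image_le (W V : finType) (f : W -> V) (p : W -> R) :
  (forall w, 0 <= p w) -> law_entropy (image_law f p) <= law_entropy p.
Proof.
move=> p0; rewrite /law_entropy [leRHS](partition_big f xpredT)//=.
by apply: ler_sum => v _; exact: eta_sum_le.
Qed.

(** Gibbs' inequality: coding with lengths [- ln q] adapted to another law [q]
  cannot beat the lengths adapted to [p]. *)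
Lemma law_entropy_gibbs (W : finType) (p q : W -> R) :
  (forall w, 0 <= p w) -> (forall w, 0 <= q w) ->
  (forall w, q w = 0 -> p w = 0) -> \sum_w q w <= \sum_w p w ->
  law_entropy p <= \sum_w p w * - ln (q w).
Proof.
move=> p0 q0 pq spq.
suff : law_entropy p - \sum_w p w * - ln (q w) <= \sum_w q w - \sum_w p w by lra.
rewrite /law_entropy -!sumrB; apply: ler_sum => w _.
move: (q0 w); rewrite le_eqVlt => /predU1P[qw|qw].
  by rewrite -qw pq// mul0r eta0.
by have := mul_ln_le (p0 w) qw; lra.
Qed.

(** Gibbs' inequality against the product of the two marginals. *)
Lemma law_entropy_subadd (V W : finType) (p : V * W -> R) :
  (forall w, 0 <= p w) -> \sum_w p w = 1 ->
  law_entropy p <= law_entropy (image_law fst p) + law_entropy (image_law snd p).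
Proof.
move=> p0 p1; set p' := image_law fst p; set p'' := image_law snd p.
have null1 v w : p' v = 0 -> p (v, w) = 0.
  by move=> /psumr_eq0P /(_ (v, w)); apply => //=.
have null2 v w : p'' w = 0 -> p (v, w) = 0.
  by move=> /psumr_eq0P /(_ (v, w)); apply => //=.
apply: (le_trans (@law_entropy_gibbs _ p (fun x => p' x.1 * p'' x.2) p0 _ _ _)).
- by move=> w; rewrite mulr_ge0// image_law_ge0.
- by case=> v w /= /eqP; rewrite mulf_eq0 => /orP[] /eqP; [exact: null1|exact: null2].
- rewrite -(pair_big xpredT xpredT (fun v w => p' v * p'' w))/=.
  under eq_bigr do rewrite -mulr_sumr image_law_mass p1 mulr1.
  by rewrite image_law_mass.
rewrite /law_entropy.
have e : forall (U : finType) (f : V * W -> U),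
    \sum_u eta (image_law f p u) = \sum_w p w * - ln (image_law f p (f w)).
  move=> U f; rewrite -(image_law_sum f p (fun u => - ln (image_law f p u))).
  by apply: eq_bigr => u _; rewrite /eta mulrN.
rewrite !e -big_split/=; apply: ler_sum => -[v w] _ /=.
have := p0 (v, w); rewrite le_eqVlt => /predU1P[<-|pvw]; first by rewrite !mul0r addr0.
rewrite lnM; first by rewrite -/p' -/p''; lra.
- rewrite posrE lt_neqAle image_law_ge0// andbT eq_sym.
  by apply: contraTneq pvw => /null1 ->; rewrite ltxx.
- rewrite posrE lt_neqAle image_law_ge0// andbT eq_sym.
  by apply: contraTneq pvw => /null2 ->; rewrite ltxx.
Qed.

(** The chain rule: [q v] is the conditional law of the second component given
  that the first one is [v]. *)
Lemma law_entropy_chain (V W : finType) (p : V -> R) (q : V -> W -> R) :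
  (forall v, 0 <= p v) -> (forall v w, 0 <= q v w) -> (forall v, \sum_w q v w = 1) ->
  law_entropy (fun x : V * W => p x.1 * q x.1 x.2) =
  law_entropy p + \sum_v p v * law_entropy (q v).
Proof.
move=> p0 q0 q1; rewrite /law_entropy.
rewrite -(pair_big xpredT xpredT (fun v w => eta (p v * q v w)))/= -big_split/=.
apply: eq_bigr => v _; under eq_bigr do rewrite etaM//.
by rewrite big_split/= -mulr_sumr -mulr_suml q1 mul1r addrC.
Qed.

End LawEntropy.

(** Fekete's lemma. Division with remainder by a fixed [m] bounds [u n / n] by
  [u m / m] plus a term that vanishes as [n] grows, so the limit is the infimum
  of these ratios. *)
Lemma subadditive_cvg (R : realType) (u : nat -> R) :
  (forall n, 0 <= u n) -> (forall m n, u (m + n)%N <= u m + u n) ->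
  cvgn (fun n => n%:R^-1 * u n).
Proof.
move=> u0 usub.
pose S := [set x : R | exists2 n, (0 < n)%N & x = n%:R^-1 * u n].
have S0 : S !=set0 by exists (1%:R^-1 * u 1%N); exists 1%N.
have lS : has_lbound S by exists 0 => _ [n _ ->]; rewrite mulr_ge0// invr_ge0 ler0n.
have umul m q : u (q * m)%N <= q%:R * u m + u 0%N.
  elim: q => [|q IH]; first by rewrite mul0n mul0r add0r.
  by rewrite mulSn -natr1; have := usub m (q * m)%N; nra.
have ulin r : u r <= r%:R * u 1%N + u 0%N by rewrite -[X in u X]muln1.
apply: (@cvgP _ _ (inf S)); apply/cvgrPdist_lt => e e0.
have e2 : 0 < e / 2 by lra.
have [_ [m m0 ->] um] := @inf_adherent _ S (e / 2) e2 (conj S0 lS).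
pose C := m%:R * u 1%N + u 0%N + u 0%N.
have C0 : 0 <= C by rewrite /C; have := u0 0%N; have := u0 1%N; have := ler0n R m; nra.
near=> n.
have n0 : (0 < n)%N by near: n; exists 1%N.
have n0' : 0 < n%:R :> R by rewrite ltr0n.
have m0' : 0 < m%:R :> R by rewrite ltr0n.
have hC : C < n%:R * (e / 2).
  rewrite -ltr_pdivrMr ?divr_gt0//; near: n; exact: nbhs_infty_gtr.
have lo : inf S <= n%:R^-1 * u n by apply: ge_inf => //; exists n.
have hi : u n <= n%:R * (m%:R^-1 * u m) + C.
  rewrite {1}(divn_eq n m).
  have h1 := usub (n %/ m * m)%N (n %% m)%N; have h2 := umul m (n %/ m)%N.
  have h3 := ulin (n %% m)%N.
  have h4 : (n %% m)%:R * u 1%N <= m%:R * u 1%N.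
    by rewrite ler_wpM2r// ler_nat ltnW// ltn_mod.
  have h5 : (n %/ m)%:R * u m <= n%:R * (m%:R^-1 * u m).
    rewrite mulrA ler_wpM2r// ler_pdivlMr// -natrM ler_nat; exact: leq_divM.
  rewrite /C; lra.
have : n%:R^-1 * u n < inf S + e.
  rewrite mulrC ltr_pdivrMr//; nra.
by rewrite ltr_norml; lra.
Unshelve. all: by end_near. Qed.

(** * Discrete random variables and undecided events *)

Section Laws.
Context {d : measure_display} {T : measurableType d} {R : realType}.
Variable P : probability T R.

Definition discrete (W : Type) (g : T -> W) :=
  forall w, measurable (g @^-1` [set w]).

Definition law (W : Type) (g : T -> W) (w : W) : R := fine (P (g @^-1` [set w])).

Lemma law_ge0 (W : Type) (g : T -> W) w : 0 <= law g w.
Proof. by rewrite fine_ge0. Qed.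

Lemma EFin_law (W : Type) (g : T -> W) w : discrete g ->
  (law g w)%:E = P (g @^-1` [set w]).
Proof. by move=> mg; rewrite fineK// fin_num_measure. Qed.

Lemma discrete_pred (W : finType) (g : T -> W) (Q : pred W) : discrete g ->
  measurable [set t | Q (g t)].
Proof.
move=> mg; have -> : [set t | Q (g t)] = \bigcup_(w in [set` Q]) g @^-1` [set w].
  by apply/seteqP; split=> [t Qt|t [w /= Qw gw]]; [exists (g t)|rewrite /= gw].
by apply: fin_bigcup_measurable => // w _; exact: mg.
Qed.

Lemma law_pred (W : finType) (g : T -> W) (Q : pred W) : discrete g ->
  P [set t | Q (g t)] = (\sum_(w | Q w) law g w)%:E.
Proof.
move=> mg; have -> : [set t | Q (g t)] = \bigcup_(w in [set` Q]) g @^-1` [set w].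
  by apply/seteqP; split=> [t Qt|t [w /= Qw gw]]; [exists (g t)|rewrite /= gw].
rewrite measure_fin_bigcup//; last by move=> w w' _ _ [t [/= <- <-]].
rewrite -(@bigfs _ _ _ _ (index_enum W)) ?index_enum_uniq//; last by move=> w _; rewrite mem_index_enum.
by rewrite -sumEFin; apply: eq_bigr => w _; rewrite EFin_law.
Qed.

Lemma discrete_comp (W V : finType) (g : T -> W) (f : W -> V) :
  discrete g -> discrete (f \o g).
Proof.
move=> mg v; rewrite (_ : _ @^-1` _ = [set t | f (g t) == v]).
  exact: (@discrete_pred _ g (fun w => f w == v)).
by apply/seteqP; split=> t /eqP.
Qed.

Lemma law_comp (W V : finType) (g : T -> W) (f : W -> V) :
  discrete g -> law (f \o g) = image_law f (law g).
Proof.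
move=> mg; apply/funext => v; rewrite /law (_ : _ @^-1` _ = [set t | f (g t) == v]).
  by rewrite (@law_pred _ g (fun w => f w == v)).
by apply/seteqP; split=> t /eqP.
Qed.

Lemma law_sum1 (W : finType) (g : T -> W) : discrete g -> \sum_w law g w = 1.
Proof.
move=> mg; apply: EFin_inj; rewrite -(@law_pred _ g xpredT)//.
by rewrite -(probability_setT P); congr (P _); apply/seteqP.
Qed.

(** Entropy sees a variable only up to an injective renaming of its values; this
  moves every computation to finite types. *)
Lemma entropy_law (W : finType) (V : choiceType) (g : T -> W) (dec : W -> V)
    (f : T -> V) :
  injective dec -> (forall t, f t = dec (g t)) ->
  entropy P f = law_entropy (law g).
Proof.
move=> dinj fE.
have pre w : f @^-1` [set dec w] = g @^-1` [set w].
  by apply/seteqP; split=> t /=; rewrite fE; [exact: dinj|move=> ->].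
rewrite /entropy (@fsbig_fwiden _ _ _ _ (map dec (index_enum W))).
- by rewrite big_map; apply: eq_bigr => w _; rewrite pre.
- by move=> _ [t _ <-]; rewrite /= fE; apply: map_f; rewrite mem_index_enum.
- by rewrite map_inj_uniq ?index_enum_uniq.
- move=> v [_ nv] /=; rewrite (_ : _ @^-1` _ = set0) ?measure0 ?eta0//.
  by apply/seteqP; split=> // t /= ft; apply: nv; exists t.
Qed.

(** The conditional probability of [E] given [G] lies in [[e, 1 - e]] on [D]. In
  this form, without conditional probabilities, the property can be tested
  directly on the atoms of a finite partition. *)
Definition undecided (G : set (set T)) (E D : set T) (e : R) :=
  [/\ 0 < e, measurable E, G D &
    forall A, G A -> A `<=` D ->
      (e%:E * P A <= P (A `&` E))%E /\ (e%:E * P A <= P (A `\` E))%E].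

(** Each atom of the [G]-measurable variable [psi \o h] is split by [E] into two
  parts that both have at least [e] times the mass of the atom inside [D]; the
  splitting costs [etaD_gap] of these parts add up to the gap. *)
Lemma undecided_gap (G : set (set T)) (E D : set T) (e : R)
    (V W : finType) (h : T -> V) (phi : V -> bool) (psi : V -> W) :
  G `<=` measurable -> setI_closed G -> undecided G E D e ->
  discrete h -> (forall t, phi (h t) <-> E t) ->
  (forall w, G ((psi \o h) @^-1` [set w])) ->
  law_entropy (law (psi \o h)) + e * fine (P D) / 2 <= law_entropy (law h).
Proof.
move=> Gm GI [e0 mE GD und] mh phiE Gh.
pose f := fun v => (phi v, psi v).
have mf : discrete (f \o h) by exact: discrete_comp.
apply: le_trans (law_entropy_image_le f (law_ge0 h)).
rewrite -law_comp//.
have fT w : (f \o h) @^-1` [set (true, w)] = (psi \o h) @^-1` [set w] `&` E.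
  apply/seteqP; split=> t /=; first by case=> /phiE.
  by case=> <- /phiE; rewrite /f => ->.
have fF w : (f \o h) @^-1` [set (false, w)] = (psi \o h) @^-1` [set w] `\` E.
  apply/seteqP; split=> t /=; first by case=> phit <-; split=> // /phiE; rewrite phit.
  by case=> <- nE; congr (_, _); apply/negbTE/negP => /phiE.
have mg : discrete (psi \o h) by exact: discrete_comp.
have lawD w : law (psi \o h) w = law (f \o h) (true, w) + law (f \o h) (false, w).
  rewrite (_ : psi \o h = snd \o (f \o h))// law_comp// /image_law.
  rewrite (eq_bigr (fun x => law (f \o h) (x.1, x.2))); last by case.
  rewrite -(pair_big xpredT (fun x => x == w) (fun b x => law (f \o h) (b, x)))/=.
  by under eq_bigr do rewrite big_pred1_eq; rewrite big_bool.
pose a w := fine (P (D `&` (psi \o h) @^-1` [set w])).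
have mD : measurable D by exact: Gm.
have sa : \sum_w a w = fine (P D).
  rewrite /a sum_fine; last by move=> w _; rewrite fin_num_measure//; exact: measurableI.
  rewrite (@bigfs _ _ _ _ _ xpredT) ?index_enum_uniq//; last first.
    by move=> w _; rewrite mem_index_enum.
  rewrite -measure_fin_bigcup//.
  - congr (fine (P _)); apply/seteqP; split=> [t [w _ []]//|t Dt].
    by exists (psi (h t)).
  - by move=> w w' _ _ [t [/= [_ <-] [_ <-]]].
  - by move=> w _; exact: measurableI.
rewrite /law_entropy.
rewrite (eq_bigr (fun x => eta (law (f \o h) (x.1, x.2)))); last by case.
rewrite -(pair_big xpredT xpredT (fun b w => eta (law (f \o h) (b, w))))/= big_bool/=.
rewrite -sa mulr_sumr mulr_suml -!big_split/=; apply: ler_sum => w _.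
rewrite lawD.
have GA : G (D `&` (psi \o h) @^-1` [set w]) by apply: GI.
have [h1 h2] := und _ GA (@subIsetl _ _ _).
have mA := Gm _ GA; have mAw := Gm _ (Gh w).
have ea : (e * a w)%:E = (e%:E * P (D `&` (psi \o h) @^-1` [set w]))%E.
  by rewrite EFinM fineK// fin_num_measure.
apply: etaD_gap.
- by rewrite mulr_ge0// ?fine_ge0// ltW.
- rewrite -lee_fin EFin_law// ea fT; apply: (le_trans h1).
  by apply: le_measure; rewrite ?inE; [exact: measurableI..|apply: setSI; exact: subIsetr].
- rewrite -lee_fin EFin_law// ea fF; apply: (le_trans h2).
  by apply: le_measure; rewrite ?inE; [exact: measurableD..|apply: setSD; exact: subIsetr].
Qed.

End Laws.

(** * Positive conditional entropy *)

Section ConditionalEntropy.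
Context {d : measure_display} {T : measurableType d} {R : realType}.
Variables (P : probability T R) (G : set (set T)).
Hypothesis Gm : G `<=` measurable.

Lemma cond_prob_ge (E A : set T) (g : T -> R) (c : R) : is_cond_prob P G E g ->
  G A -> (forall t, A t -> c <= g t) -> (c%:E * P A <= P (A `&` E))%E.
Proof.
case=> _ ig Eg GA cg; rewrite -Eg// -integral_cst; last exact: Gm.
apply: le_integral; [exact: Gm|..].
- by apply: finite_measure_integrable_cst; exact: Gm.
- by apply: integrableS ig => //; exact: Gm.
- by move=> t; rewrite inE => At; rewrite lee_fin cg.
Qed.

Lemma cond_prob_le (E A : set T) (g : T -> R) (c : R) : is_cond_prob P G E g ->
  G A -> (forall t, A t -> g t <= c) -> (P (A `&` E) <= c%:E * P A)%E.
Proof.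
case=> _ ig Eg GA cg; rewrite -Eg// -integral_cst; last exact: Gm.
apply: le_integral; [exact: Gm|..].
- by apply: integrableS ig => //; exact: Gm.
- by apply: finite_measure_integrable_cst; exact: Gm.
- by move=> t; rewrite inE => At; rewrite lee_fin cg.
Qed.

Lemma cond_prob_undecided (E : set T) (g : T -> R) (e : R) : measurable E ->
  is_cond_prob P G E g -> 0 < e ->
  undecided P G E (g @^-1` [set` `[e, 1 - e]]) e.
Proof.
move=> mE cg e0; split => //; first by case: cg => + _ _; apply.
move=> A GA Ag; have mA := Gm GA.
have lo : (e%:E * P A <= P (A `&` E))%E.
  by apply: cond_prob_ge cg GA _ => t /Ag; rewrite /= in_itv/= => /andP[].
have hi : (P (A `&` E) <= (1 - e)%:E * P A)%E.
  by apply: cond_prob_le cg GA _ => t /Ag; rewrite /= in_itv/= => /andP[].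
split=> //; move: hi.
have -> : P (A `\` E) = (P A - P (A `&` E))%E.
  by rewrite -measureD// (le_lt_trans (probability_le1 _ _)) ?ltry.
rewrite -(@fineK _ (P A)) ?fin_num_measure//.
rewrite -(@fineK _ (P (A `&` E))) ?fin_num_measure//; last exact: measurableI.
by rewrite -!EFinM -EFinB !lee_fin; lra.
Qed.

Lemma cond_prob_gt1 (E : set T) (g : T -> R) (e : R) : measurable E ->
  is_cond_prob P G E g -> 0 < e -> P (g @^-1` [set` `[1 + e, +oo[]) = 0%E.
Proof.
move=> mE cg e0; set A := g @^-1` _.
have GA : G A by case: cg => + _ _; apply.
have mA := Gm GA.
have : ((1 + e)%:E * P A <= P (A `&` E))%E.
  by apply: cond_prob_ge cg GA _ => t; rewrite /A /= in_itv/= andbT.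
have : (P (A `&` E) <= P A)%E.
  by apply: le_measure; rewrite ?inE//; exact: measurableI.
move=> /[swap] /le_trans/[apply].
rewrite -(@fineK _ (P A)) ?fin_num_measure//= -EFinM lee_fin => h.
have := @fine_ge0 _ (P A) (measure_ge0 _ _) => p0.
by congr EFin; nra.
Qed.

(** The real [eta x] is nonzero only if [0 < x < 1] or [1 < x]. The first case
  is covered by the countably many events where [g] lies in [[e, 1 - e]], the
  second one by events that are null because [g] is a conditional probability.
  At [x <= 0] the logarithm is 0 by convention. *)
Lemma eta_cond_prob_negligible (E : set T) (g : T -> R) : measurable E ->
  is_cond_prob P G E g ->
  (forall D e, undecided P G E D e -> P D = 0%E) ->
  P.-negligible [set t | eta (g t) <> 0].
Proof.
move=> mE cg und.
have mg (I : set R) : measurable I -> measurable (g @^-1` I).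
  by move=> mI; apply: Gm; case: cg => + _ _; apply.
pose e n : R := n.+1%:R^-1.
have e0 n : 0 < e n by rewrite invr_gt0.
have F0 : P.-negligible (\bigcup_n
    (g @^-1` [set` `[e n, 1 - e n]] `|` g @^-1` [set` `[1 + e n, +oo[])).
  apply: negligible_bigcup => n; apply: negligibleU.
    apply/negligibleP; first exact: mg.
    by apply: (und _ (e n)); exact: cond_prob_undecided.
  apply/negligibleP; first exact: mg.
  by apply: cond_prob_gt1 cg _.
apply: negligibleS F0 => t /= et.
have near0 (x : R) : 0 < x -> exists n, e n <= x.
  move=> x0; exists (Num.truncn x^-1); rewrite /e -[leRHS]invrK lef_pV2 ?posrE ?invr_gt0//.
  exact/ltW/truncnS_gt.
have [g0|g0] := leP (g t) 0; first by case: et; rewrite /eta ln0// mulr0 oppr0.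
have [g1|g1|g1] := ltgtP (g t) 1.
- have [n en] : exists n, e n <= Num.min (g t) (1 - g t).
    by apply: near0; rewrite lt_min g0 subr_gt0.
  exists n => //; left; rewrite /= in_itv/=; move: en; rewrite le_min => /andP[-> ?].
  by lra.
- have [n en] := near0 (g t - 1) ltac:(lra).
  by exists n => //; right; rewrite /= in_itv/= andbT; lra.
- by case: et; rewrite g1 /eta ln1 mulr0 oppr0.
Qed.

Lemma measurable_eta : measurable_fun setT (@eta R).
Proof.
apply: measurableT_comp => //; apply: measurable_funM => //; exact: measurable_ln.
Qed.

(** If no event were undecided, each term of the integrand would vanish almost
  surely, and the expectation would be 0. Where no version of the conditional
  probability exists, the chosen function is the constant 0, whose entropy term
  vanishes as well. *)
Lemma cond_entropy_undecided (V : choiceType) (f : T -> V) :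
  (forall v, measurable (f @^-1` [set v])) -> finite_set (range f) ->
  cond_entropy P f G <> 0%E ->
  exists v D e, undecided P G (f @^-1` [set v]) D e /\ P D <> 0%E.
Proof.
move=> mf ff; apply: contra_notP => /forallNP noD.
have und v D e : undecided P G (f @^-1` [set v]) D e -> P D = 0%E.
  by move=> h; apply: contrapT => h'; apply: (noD v); exists D, e.
pose g v := cond_prob P G (f @^-1` [set v]).
have gE v : is_cond_prob P G (f @^-1` [set v]) (g v) \/ g v = fun=> 0.
  by rewrite /g /cond_prob; case: xgetP => [h _ ?|]; [left|right].
have mg v : measurable_fun setT (g v).
  case: (gE v) => [[mg _ _]|->]; last exact: measurable_cst.
  by move=> _ B mB; rewrite setTI; apply: Gm; exact: mg.
have neg v : P.-negligible [set t | eta (g v t) <> 0].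
  case: (gE v) => [cg|->]; last first.
    by apply: negligibleS (negligible_set0 P) => t /=; rewrite eta0.
  by apply: eta_cond_prob_negligible cg _ => // D e; exact: und.
rewrite /cond_entropy unlock (ae_eq_integral (cst 0%E)) ?integral0//.
- apply/measurable_EFinP; under eq_fun do rewrite fsbig_finite//.
  by apply: measurable_sum => v; exact: measurableT_comp measurable_eta (mg v).
- have ae0 (s : seq V) : {ae P, forall t, forall v, v \in s -> eta (g v t) = 0}.
    elim: s => [|v s IH]; first by apply: aeW.
    have nv : {ae P, forall t, eta (g v t) = 0}.
      by apply: negligibleS (neg v) => t /=.
    move: nv IH; apply: filterS2 => t nvt IHt u; rewrite inE => /predU1P[->//|]; exact: IHt.
  have := ae0 (finmap.enum_fset (fset_set (range f))); apply: filterS => t h _ /=.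
  by rewrite fsbig_finite// big_seq big1.
Qed.

End ConditionalEntropy.

(** * Words of a stationary process *)

Section GeneratedSigmaAlgebra.
Context {U : Type} {R : realType}.
Variables (Z : int -> U -> R) (I : set int).

Lemma sigma_gen_setTI : sigma_gen Z I setT /\ setI_closed (sigma_gen Z I).
Proof.
have /sigma_algebraP [] // := @smallest_sigma_algebra _ setT
  (\bigcup_(i in I) preimage_set_system setT (Z i) measurable).
Qed.

Lemma sigma_gen_cylinder (n : nat) (i : 'I_n -> int) (Q : pred 'I_n) (a : 'I_n -> R) :
  (forall k, Q k -> I (i k)) ->
  sigma_gen Z I [set u | forall k, Q k -> Z (i k) u = a k].
Proof.
move=> QI; have [GT GI] := sigma_gen_setTI.
suff h (s : seq 'I_n) :
    sigma_gen Z I [set u | forall k, k \in s -> Q k -> Z (i k) u = a k].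
  have -> : [set u | forall k, Q k -> Z (i k) u = a k] =
      [set u | forall k, k \in enum 'I_n -> Q k -> Z (i k) u = a k].
    apply/seteqP; split=> u /= hu k; first by move=> _; exact: hu.
    by apply: hu; rewrite mem_enum.
  exact: h.
elim: s => [|k s IH]; first by rewrite (_ : [set _ | _] = setT)//; apply/seteqP; split.
have -> : [set u | forall k', k' \in k :: s -> Q k' -> Z (i k') u = a k'] =
    [set u | Q k -> Z (i k) u = a k] `&`
    [set u | forall k', k' \in s -> Q k' -> Z (i k') u = a k'].
  apply/seteqP; split=> u /= => [hu|[hk hs] k'].
    split=> [Qk|k' k's]; first by apply: hu => //; rewrite mem_head.
    by apply: hu; rewrite inE k's orbT.
  by rewrite inE => /predU1P[->|]; [exact: hk|exact: hs].
apply: GI => //; case: (boolP (Q k)) => Qk; last first.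
  by rewrite (_ : [set _ | _] = setT)//; apply/seteqP; split.
apply: sub_gen_smallest; exists (i k); first exact: QI.
by exists [set a k] => //; rewrite setTI; apply/seteqP; split=> u /=; [|]; auto.
Qed.

End GeneratedSigmaAlgebra.

Lemma sigma_gen_measurable (d : measure_display) (T : measurableType d)
    (R : realType) (Z : int -> T -> R) (I : set int) :
  is_process Z -> sigma_gen Z I `<=` measurable.
Proof.
move=> mZ; apply: smallest_sub; first exact: sigma_algebra_measurable.
by move=> _ [i _ [B mB <-]]; exact: mZ.
Qed.

Section Windows.
Context {d : measure_display} {T : measurableType d} {R : realType}.
Variable P : probability T R.

Definition window (S : Type) (c : int -> T -> S) (m : int) (n : nat) (t : T) :
  {ffun 'I_n -> S} := [ffun k : 'I_n => c (m + k%:Z) t].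

(** Stationarity as far as the entropies of words can see it. In this form it
  passes to the masked process without a monotone class argument. *)
Definition window_stationary (S : finType) (c : int -> T -> S) :=
  (forall m n, discrete (window c m n)) /\
  (forall m n, law P (window c m n) = law P (window c 0 n)).

Definition coding (S : Type) (Z : int -> T -> R) (c : int -> T -> S) (dec : S -> R) :=
  injective dec /\ forall i t, Z i t = dec (c i t).

Section Coding.
Context {S : finType}.
Variables (Z : int -> T -> R) (c : int -> T -> S) (dec : S -> R).
Hypothesis Zc : coding Z c dec.

Lemma window_preimage m n (A : pred 'I_n) (u : {ffun 'I_n -> S}) :
  [set t | forall k, A k -> window c m n t k = u k] =
  [set t | forall k : 'I_n, A k -> Z (m + k%:Z) t = dec (u k)].
Proof.
case: Zc => dinj Zd; apply/seteqP; split=> t h k /h.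
  by rewrite ffunE Zd => ->.
by rewrite ffunE Zd => /dinj.
Qed.

Lemma window_eq m n (u : {ffun 'I_n -> S}) :
  window c m n @^-1` [set u] =
  [set t | forall k : 'I_n, xpredT k -> Z (m + k%:Z) t = dec (u k)].
Proof.
rewrite -window_preimage; apply/seteqP; split=> t /=; first by move=> ->.
by move=> h; apply/ffunP => k; exact: h.
Qed.

Lemma sigma_gen_window m n u : sigma_gen Z setT (window c m n @^-1` [set u]).
Proof.
by rewrite window_eq; exact: (@sigma_gen_cylinder _ _ Z setT n (fun k => m + k%:Z)).
Qed.

Lemma window_stationaryP : is_process Z -> stationary P Z -> window_stationary c.
Proof.
move=> mZ sZ; split=> [m n u|].
  by apply: (sigma_gen_measurable mZ); exact: sigma_gen_window.
have step m n : law P (window c (m + 1) n) = law P (window c m n).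
  apply/funext => u; rewrite /law !window_eq.
  have /sZ := @sigma_gen_cylinder _ _ (fun i (x : int -> R) => x i) setT n
    (fun k => m + k%:Z) xpredT (fun k => dec (u k)) (fun _ _ => I).
  rewrite /sample_path /left_shift /= => <-; congr (fine (P _)).
  by apply/seteqP; split=> t h k /h; rewrite addrAC.
move=> + n; elim/int_rect => [//|m IH|m IH].
  by rewrite (_ : m.+1%:Z = m%:Z + 1) ?step//; lia.
by rewrite -IH -(step (- m.+1%:Z)) (_ : - m.+1%:Z + 1 = - m%:Z)//; lia.
Qed.

Lemma entropy_word n : entropy P (word Z n) = law_entropy (law P (window c 0 n)).
Proof.
apply: (@entropy_law _ _ _ _ _ _ _ (fun u : {ffun 'I_n -> S} => [tuple dec (u i) | i < n])).
  move=> u v /(congr1 (fun x => tnth x _)) uv; apply/ffunP => k.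
  by have := uv k; rewrite !tnth_mktuple; case: Zc => + _; apply.
by case: Zc => _ Zd t; apply: eq_from_tnth => k; rewrite !tnth_mktuple Zd ffunE add0r.
Qed.

End Coding.

Lemma law_entropy_ge0 (W : finType) (g : T -> W) :
  discrete g -> 0 <= law_entropy (law P g).
Proof.
move=> mg.
apply: sumr_ge0 => w _; rewrite /eta -mulrN mulr_ge0 ?law_ge0// oppr_ge0 ln_le0//.
by rewrite -lee_fin EFin_law ?probability_le1//; exact: mg.
Qed.

(** Words are subadditive: a long word is glued from two shorter ones, and the
  second of them may be shifted to the origin. *)
Lemma rate_cvg (S : finType) (c : int -> T -> S) : window_stationary c ->
  cvgn (fun n => n%:R^-1 * law_entropy (law P (window c 0 n))).
Proof.
move=> [mc sc]; apply: subadditive_cvg => [n|m n]; first by apply: law_entropy_ge0; exact: mc.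
pose f t := (window c 0 m t, window c m%:Z n t).
pose glue (x : {ffun 'I_m -> S} * {ffun 'I_n -> S}) : {ffun 'I_(m + n) -> S} :=
  [ffun k => match fintype.split k with inl i => x.1 i | inr j => x.2 j end].
have mf : discrete f.
  move=> [u v]; rewrite (_ : _ @^-1` _ =
    (window c 0 m @^-1` [set u]) `&` (window c m%:Z n @^-1` [set v])).
    by apply: measurableI; exact: mc.
  by apply/seteqP; split=> t /= => [[<- <-]|[<- <-]].
have -> : window c 0 (m + n) = glue \o f.
  apply/funext => t; apply/ffunP => k; rewrite !ffunE.
  by case: splitP => i ki; rewrite ffunE ki ?PoszD ?add0r ?addrA.
rewrite law_comp//; apply: le_trans (law_entropy_image_le _ (law_ge0 _ _)) _.
apply: le_trans (law_entropy_subadd (law_ge0 _ _) (law_sum1 P mf)) _.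
by rewrite -!law_comp// -(sc m%:Z n).
Qed.

Lemma joint_law (S S' : finType) (c : int -> T -> S) (c' : int -> T -> S')
    (X Y : int -> T -> R) (decX : S -> R) (decY : S' -> R) m n :
  is_process X -> is_process Y -> indep_processes P X Y ->
  coding X c decX -> coding Y c' decY ->
  let f t := (window c m n t, window c' m n t) in
  discrete f /\
  forall x, law P f x = law P (window c m n) x.1 * law P (window c' m n) x.2.
Proof.
move=> mX mY iXY Xc Yc f.
have fE x : f @^-1` [set x] =
    (window c m n @^-1` [set x.1]) `&` (window c' m n @^-1` [set x.2]).
  by case: x => u v; apply/seteqP; split=> t /= => [[<- <-]|[<- <-]].
have mu u : measurable (window c m n @^-1` [set u]).
  exact: (sigma_gen_measurable mX (sigma_gen_window Xc m u)).
have mv v : measurable (window c' m n @^-1` [set v]).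
  exact: (sigma_gen_measurable mY (sigma_gen_window Yc m v)).
split=> x; first by rewrite fE; exact: measurableI.
rewrite /law fE iXY; [|exact: (sigma_gen_window Xc)|exact: (sigma_gen_window Yc)].
by rewrite fineM// fin_num_measure.
Qed.

End Windows.

(** Masking stands for the restriction of a word to [A]. Filling in a default
  letter keeps the restrictions to all sets of times in a single type. *)
Definition mask (S : Type) (s0 : S) (n : nat) (A : {set 'I_n}) (u : {ffun 'I_n -> S}) :
  {ffun 'I_n -> S} := [ffun k => if k \in A then u k else s0].

Lemma mask_mask (S : Type) (s0 : S) n (A B : {set 'I_n}) (u : {ffun 'I_n -> S}) :
  A \subset B -> mask s0 A (mask s0 B u) = mask s0 A u.
Proof.
move=> /fintype.subsetP AB; apply/ffunP => k; rewrite !ffunE.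
by case: ifP => // /AB ->.
Qed.

Definition slot (n L r : nat) : {set 'I_n} := [set k : 'I_n | (k %/ L)%N == r].

(** * Entropy hidden in a slot *)

Section HiddenSlots.
Context {d : measure_display} {T : measurableType d} {R : realType}.
Variables (P : probability T R) (S : finType) (s0 : S).
Variables (X : int -> T -> R) (c : int -> T -> S) (dec : S -> R).
Hypotheses (mX : is_process X) (sX : stationary P X) (Xc : coding X c dec).
Variables (L : nat) (v : L.-tuple R) (D : set T) (e : R).
Hypothesis L0 : (0 < L)%N.
Hypothesis und : undecided P (sigma_gen X [set i : int | i <= -1 \/ L%:Z <= i])
  (word X L @^-1` [set v]) D e.

Let gap := e * fine (P D) / 2.

(** By stationarity the slot may be moved to the origin; there the word that it
  carries is undecided by everything outside of it. *)
Lemma slot_gap n r (B : {set 'I_n}) :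
  (r.+1 * L <= n)%N -> [forall k in B, (k %/ L)%N != r] ->
  law_entropy (image_law (mask s0 B) (law P (window c 0 n))) + gap <=
  law_entropy (image_law (mask s0 (B :|: slot n L r)) (law P (window c 0 n))).
Proof.
move=> rn dis; have [mc sc] := window_stationaryP Xc mX sX.
(* The window starts at [- (r * L)], so that the slot becomes [[0, L)]. *)
rewrite -(sc (- (r * L)%N%:Z) n) -!law_comp; [|exact: mc..].
set w := window c _ n; set h := mask s0 (B :|: slot n L r) \o w.
have -> : mask s0 B \o w = mask s0 B \o h.
  by apply/funext => t; rewrite /h /= mask_mask// finset.subsetUl.
(* The word [v] occurs in the slot. *)
pose phi (y : {ffun 'I_n -> S}) :=
  [forall k in slot n L r, dec (y k) == nth 0 v (k - r * L)].
have mh : discrete h by apply: discrete_comp; exact: mc.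
apply: (@undecided_gap _ _ _ _ _ _ _ _ _ _ h phi) und mh _ _.
- exact: sigma_gen_measurable.
- by case: (@sigma_gen_setTI _ _ X [set i : int | i <= -1 \/ L%:Z <= i]).
- have [_ Xd] := Xc.
  have hX t (k : 'I_n) : k \in slot n L r -> dec (h t k) = X (k - r * L)%N%:Z t.
    rewrite inE => /eqP kr; rewrite Xd /h /= ffunE inE [k \in slot _ _ _]inE kr eqxx orbT.
    by rewrite ffunE; congr (dec (c _ t)); have := leq_trunc_div k L; rewrite kr; lia.
  move=> t; split=> [/forall_inP ht|ht].
    apply: eq_from_tnth => i; rewrite tnth_mktuple.
    have kn : (r * L + i < n)%N by have := ltn_ord i; lia.
    have ks : Ordinal kn \in slot n L r.
      by rewrite inE /= divnMDl// divn_small ?addn0.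
    have /eqP := ht _ ks; rewrite hX//= addKn => ->; exact: esym (tnth_nth _ _ _).
  apply/forall_inP => k ks; rewrite hX// -ht.
  have kL : (k - r * L < L)%N.
    by move: ks; rewrite inE => /eqP <-; rewrite {1}(divn_eq k L) addKn ltn_pmod.
  by rewrite -[X in nth _ _ X]/(nat_of_ord (Ordinal kL)) -tnth_nth tnth_mktuple.
- move=> u; have [GT _] := @sigma_gen_setTI _ _ X [set i : int | i <= -1 \/ L%:Z <= i].
  have [[t0 t0u]|none] := pselect (exists t, mask s0 B (h t) = u); last first.
    rewrite (_ : _ @^-1` _ = set0); last first.
      by apply/seteqP; split=> t //= tu; apply: none; exists t.
    by have [] := @smallest_sigma_algebra _ setT (\bigcup_(i in
      [set i : int | i <= -1 \/ L%:Z <= i]) preimage_set_system setT (X i) measurable).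
  rewrite (_ : _ @^-1` _ = [set t | forall k, k \in B -> w t k = w t0 k]).
    rewrite (window_preimage Xc _ (fun k => k \in B)); apply: sigma_gen_cylinder => k kB /=.
    have /forall_inP/(_ _ kB) := dis; case: ltngtP => // kr _; [left|right].
      by have := divn_eq k L; have := ltn_pmod k L0; nia.
    by have := leq_trunc_div k L; nia.
  rewrite -t0u; apply/seteqP; split=> t /=.
    move=> /ffunP ht k kB; have := ht k.
    by rewrite !mask_mask ?finset.subsetUl// !ffunE kB.
  by move=> ht; rewrite !mask_mask ?finset.subsetUl//; apply/ffunP => k; have := ht k;
     rewrite !ffunE; case: ifP => // _; apply.
Qed.

Definition free_slot n (A : {set 'I_n}) (r : nat) :=
  [forall k in A, (k %/ L)%N != r].

(** The free slots are revealed one after the other; [B q] contains the times that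
  are visible once those with index below [q] have been treated, and each step
  is an instance of [slot_gap]. *)
Lemma free_slots_gap n (A : {set 'I_n}) :
  law_entropy (image_law (mask s0 A) (law P (window c 0 n))) +
    gap * (\sum_(r < n %/ L) free_slot A r)%:R <=
  law_entropy (law P (window c 0 n)).
Proof.
pose B q := A :|: [set k : 'I_n | (k %/ L < q)%N && free_slot A (k %/ L)].
suff h q : (q <= n %/ L)%N ->
    law_entropy (image_law (mask s0 A) (law P (window c 0 n))) +
      gap * (\sum_(r < q) free_slot A r)%:R <=
    law_entropy (image_law (mask s0 (B q)) (law P (window c 0 n))).
  apply: le_trans (h _ (leqnn _)) _; apply: law_entropy_image_le => u; exact: law_ge0.
elim: q => [_|q IH qn].
  rewrite big_ord0 mulr0 addr0 (_ : B 0%N = A)//.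
  by apply/setP => k; rewrite !inE ltn0 andFb orbF.
rewrite big_ord_recr/= natrD mulrDr addrA.
apply: le_trans (lerD (IH (ltnW qn)) (lexx _)) _.
case: (boolP (free_slot A q)) => fq; last first.
  rewrite mulr0 addr0 (_ : B q.+1 = B q)//; apply/setP => k; rewrite !inE ltnS leq_eqVlt.
  by case: eqVneq => //= ->; rewrite (negbTE fq) ltnn.
rewrite mulr1 (_ : B q.+1 = B q :|: slot n L q); last first.
  apply/setP => k; rewrite !inE ltnS leq_eqVlt -orbA; congr orb.
  by case: eqVneq => [->|_] /=; rewrite ?fq ?orbT ?orbF.
apply: slot_gap; first by rewrite -leq_divRL.
apply/forall_inP => k; rewrite !inE => /orP[|/andP[/ltn_eqF-> //]].
by move: k; apply/forall_inP.
Qed.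

End HiddenSlots.

(** * Long runs of zeros *)

Lemma int_min (A : set int) (b : int) : (forall j, A j -> b <= j) -> A !=set0 ->
  exists2 m, A m & forall j, A j -> m <= j.
Proof.
move=> Ab [a Aa].
pose Q n := `[< A (b + n%:Z) >].
have exQ : exists n, Q n.
  exists `|a - b|%N; apply/asboolP; rewrite (_ : b + _ = a)//.
  by have := Ab _ Aa; lia.
case: (ex_minnP exQ) => n /asboolP An nmin; exists (b + n%:Z) => // j Aj.
have /nmin : Q `|j - b|%N.
  apply/asboolP; rewrite (_ : b + _ = j)//.
  by have := Ab _ Aj; lia.
by have := Ab _ Aj; lia.
Qed.

Lemma infimum_min (A : set int) m : A m -> (forall j, A j -> m <= j) ->
  infimum 0 A = m.
Proof.
move=> Am mA; have infm : infimums A m by split=> // x; apply.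
rewrite /infimum; case: eqP => [A0|_]; first by rewrite A0 in Am.
by apply: xget_unique => // x infx; exact: (is_subset1_infimums infx infm).
Qed.

Section ZeroRuns.
Context {d : measure_display} {T : measurableType d} {R : realType}.

(** For [k > 0] the event [R_1 = k] depends on the coordinates [0, ..., k] only,
  hence is measurable. A path with fewer than two successes in the future has
  [R_1 = 0] by convention, which [k > 0] excludes. *)
Lemma return_time1 (y : int -> R) (k : nat) : (0 < k)%N ->
  return_time y 1 = k%:Z <->
  y k%:Z = 1 /\ exists2 r : nat, (r < k)%N & forall j : nat, (j < k)%N -> y j%:Z = 1 <-> j = r.
Proof.
move=> k0; rewrite -[return_time y 1]/(return_pos y 1) /=.
set A0 := [set j : int | 0 <= j /\ y j = 1].
split=> [|[yk [r rk yr]]]; last first.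
  have yr1 : y r%:Z = 1 by exact/yr.
  have -> : infimum 0 A0 = r%:Z.
    apply: infimum_min; first by split.
    move=> [j|j] [j0 yj]; last by lia.
    case: (ltnP j k) => jk; last by lia.
    by rewrite (proj1 (yr _ jk) yj).
  apply: infimum_min; first by split=> //; lia.
  move=> [j|j] [rj yj]; last by lia.
  case: (ltnP j k) => jk; last by lia.
  by have := proj1 (yr _ jk) yj; lia.
set A1 := [set j | _ < j /\ y j = 1].
have [A10|] := eqVneq A1 set0; first by rewrite A10 /infimum eqxx; lia.
move=> /set0P /(@int_min _ (infimum 0 A0)) [j [+ _]|m [rm ym] mmin]; first exact: ltW.
rewrite (infimum_min _ mmin)// => mk; subst m.
have A0n : A0 !=set0 by exists k%:Z; split.
have [m [m0 ym'] mmin'] : exists2 m, A0 m & forall j, A0 j -> m <= j.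
  by apply: (@int_min _ 0) => // j [].
move: rm mmin; rewrite /A1 (infimum_min _ mmin')// => mk mmin.
case: m m0 ym' mmin' mk mmin {A1} => // m _ ym' mmin' mk mmin.
split=> //; exists m; first by lia.
move=> j jk; split=> [yj|->//].
have /mmin' mj : A0 j%:Z by [].
have [//|jm] := eqVneq j m.
have : k%:Z <= j%:Z by apply: mmin; split=> //; lia.
by lia.
Qed.

Variables (P : probability T R) (Y : int -> T -> R) (c : int -> T -> bool).
Hypotheses (mY : is_process Y) (sY : stationary P Y).
Hypothesis Yc : coding Y c (fun b : bool => b%:R).

(** If the second success comes after time [2 L], the first success lies in at
  most one of the slots [[0, L)] and [[L, 2 L)], so that one of them is free of
  successes; by stationarity both are so with the same probability. *)
Lemma zero_run (L : nat) :
  infinite_set [set k : nat |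
    (0 < P [set w | return_time (sample_path Y w) 1%R = k%:Z])%E] ->
  0 < law P (window c 0 L) [ffun=> false].
Proof.
move=> inf; have [mc sc] := window_stationaryP Yc mY sY.
have [k kL Pk] : exists2 k, (L + L < k)%N &
    (0 < P [set w | return_time (sample_path Y w) 1%R = k%:Z])%E.
  apply: contrapT => no; apply: inf; apply: (@sub_finite_set _ _ `I_(L + L).+1) => //.
  by move=> k Pk /=; rewrite ltnNge; apply/negP => kL; apply: no; exists k.
have Y1 i t : (Y i t = 1) <-> c i t.
  by case: Yc => _ ->; case: (c i t); split=> // /esym/eqP; rewrite oner_eq0.
pose phi (u : {ffun 'I_k.+1 -> bool}) :=
  u ord_max && [exists r : 'I_k, [forall j : 'I_k, u (widen_ord (leqnSn k) j) == (j == r)]].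
have evE : [set w | return_time (sample_path Y w) 1%R = k%:Z] =
    [set w | phi (window c 0 k.+1 w)].
  apply/seteqP; split=> t /=; rewrite return_time1; [|lia| |lia]; rewrite /sample_path /phi.
    move=> [/Y1 yk [r rk yr]]; rewrite ffunE/= add0r yk /=.
    apply/existsP; exists (Ordinal rk); apply/forallP => j; rewrite ffunE/= add0r.
    apply/eqP; apply/idP/eqP => [/Y1/(yr _ (ltn_ord j)) jr|->]; first exact: val_inj.
    exact/Y1/yr.
  rewrite ffunE/= add0r => /andP[yk /existsP[r /forallP ur]]; split; first exact/Y1.
  exists r => // j jk; have := ur (Ordinal jk); rewrite ffunE/= add0r => /eqP cj.
  rewrite Y1 cj; split=> [/eqP/(congr1 val)//|jr]; apply/eqP; exact: val_inj.
rewrite lt_neqAle law_ge0 andbT eq_sym; apply/eqP => p0.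
have zero m : P (window c m L @^-1` [set [ffun=> false]]) = 0%E.
  by rewrite -EFin_law ?sc ?p0.
move: Pk; rewrite evE ltNge => /negP; apply.
have : (P (window c 0 L @^-1` [set [ffun=> false]] `|`
          window c L%:Z L @^-1` [set [ffun=> false]]) <= 0)%E.
  rewrite -[leRHS](adde0 0%E) -{1}(zero 0) -(zero L%:Z).
  by apply: measureU2; exact: mc.
apply: le_trans; apply: le_measure; rewrite ?inE.
- by apply: discrete_pred; exact: mc.
- by apply: measurableU; exact: mc.
move=> t /= /andP[_ /existsP[r /forallP ur]].
have cj (j : nat) : (j < k)%N -> j != r -> c j%:Z t = false.
  move=> jk jr; have := ur (Ordinal jk); rewrite ffunE/= add0r => /eqP ->.
  by apply/negbTE; apply: contra jr => /eqP <-.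
have [rL|rL] := ltnP r L; [right|left]; apply/ffunP => i; rewrite !ffunE ?add0r.
  by rewrite -PoszD cj//; have := ltn_ord i; lia.
by rewrite cj//; have := ltn_ord i; lia.
Qed.

End ZeroRuns.

(** * The masked process *)

Lemma finitely_valued_coding (d : measure_display) (T : measurableType d)
    (R : realType) (Z : int -> T -> R) : finitely_valued Z ->
  exists (S : finType) (c : int -> T -> S) (dec : S -> R), coding Z c dec.
Proof.
move=> [A /finite_seqP[s ->] Zs].
exists (seq_sub s), (fun i t => SeqSub (Zs i t)), val.
by split=> //; exact: val_inj.
Qed.

Section MaskedProcess.
Context {d : measure_display} {T : measurableType d} {R : realType}.
Variables (P : probability T R) (X Y : int -> T -> R).
Hypothesis gXY : good P X Y.
Variables (S : finType) (cX : int -> T -> S) (decX : S -> R).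
Hypothesis Xc : coding X cX decX.

Definition success (i : int) (t : T) : bool := Y i t == 1.

Lemma success_coding : coding Y success (fun b : bool => b%:R).
Proof.
split=> [[] [] /eqP|i t]; rewrite ?oner_eq0 1?eq_sym ?oner_eq0//.
by rewrite /success; case: (good_binaryY gXY i t) => ->; rewrite ?eqxx// eq_sym oner_eq0.
Qed.

Definition mul_dec (x : S * bool) : R := decX x.1 * x.2%:R.

(** The letters of the product process are the finitely many products, not the
  pairs: distinct pairs may have the same product, and a coding is injective. *)
Definition mul_code (i : int) (t : T) : seq_sub (codom mul_dec) :=
  SeqSub (codom_f mul_dec (cX i t, success i t)).

Lemma mul_coding : coding (mul_process X Y) mul_code val.
Proof.
split=> [|i t]; first exact: val_inj.
have [_ Xd] := Xc; have [_ Yd] := success_coding.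
by rewrite /mul_process Xd Yd.
Qed.

Let wX := window_stationaryP Xc (good_processX gXY) (good_stationaryX gXY).
Let wY := window_stationaryP success_coding (good_processY gXY) (good_stationaryY gXY).
Let joint m n := joint_law m n (good_processX gXY) (good_processY gXY)
  (good_indep gXY) Xc success_coding.

Let read n (x : {ffun 'I_n -> S} * {ffun 'I_n -> bool}) :
    {ffun 'I_n -> seq_sub (codom mul_dec)} :=
  [ffun k => SeqSub (codom_f mul_dec (x.1 k, x.2 k))].

Let mul_window m n : window mul_code m n =
  @read n \o (fun t => (window cX m n t, window success m n t)).
Proof. by apply/funext => t; apply/ffunP => k; rewrite !ffunE. Qed.

(** The joint law of the words of two independent stationary processes is the
  product of the two laws, hence independent of the position. *)
Lemma mul_window_stationary : window_stationary P mul_code.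
Proof.
split=> m n; have [mf lf] := joint m n.
  by rewrite mul_window; exact: discrete_comp.
rewrite !mul_window !law_comp//; last by case: (joint 0 n).
congr image_law; apply/funext => x; rewrite lf (proj2 (joint 0 n)).
by rewrite (proj2 wX) (proj2 wY).
Qed.

(** The masked word is a function of the positions of the successes and of the
  letters of [X] there, whose joint entropy is given by the chain rule. *)
Lemma mul_entropy_le (s0 : S) n :
  law_entropy (law P (window mul_code 0 n)) <=
  law_entropy (law P (window success 0 n)) +
  \sum_y law P (window success 0 n) y *
    law_entropy (image_law (mask s0 [set k | y k]) (law P (window cX 0 n))).
Proof.
set pY := law P (window success 0 n); set pX := law P (window cX 0 n).
have [mf lf] := joint 0 n; have [mX _] := wX; have [mY _] := wY.
pose hide (x : {ffun 'I_n -> S} * {ffun 'I_n -> bool}) := (x.2, mask s0 [set k | x.2 k] x.1).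
pose read' (x : {ffun 'I_n -> bool} * {ffun 'I_n -> S}) := read (x.2, x.1).
have -> : window mul_code 0 n =
    read' \o (hide \o (fun t => (window cX 0 n t, window success 0 n t))).
  rewrite mul_window; apply/funext => t; apply/ffunP => k; apply: val_inj.
  rewrite /= !ffunE /mul_dec /= inE ffunE.
  by case: success; rewrite ?mulr0.
rewrite law_comp; last exact: discrete_comp.
apply: le_trans (law_entropy_image_le _ (law_ge0 _ _)) _.
rewrite law_comp//.
have -> : image_law hide (law P (fun t => (window cX 0 n t, window success 0 n t))) =
    (fun x => pY x.1 * image_law (mask s0 [set k | x.1 k]) pX x.2).
  apply/funext => -[y v]; rewrite /image_law /hide /=.
  under eq_bigr do rewrite lf.
  rewrite mulr_sumr.
  rewrite (eq_bigl (fun x => (mask s0 [set k | y k] x.1 == v) && (x.2 == y))); last first.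
    by case=> u y' /=; rewrite xpair_eqE; case: (eqVneq y' y) => [->|_]; rewrite ?andbT ?andbF.
  rewrite -(pair_big (fun u => mask s0 [set k | y k] u == v) (fun y' => y' == y)
    (fun u y' => pX u * pY y'))/=.
  by apply: eq_bigr => u _; rewrite big_pred1_eq mulrC.
rewrite (@law_entropy_chain _ _ _ pY (fun y => image_law (mask s0 [set k | y k]) pX))//.
- by move=> y; exact: law_ge0.
- by move=> y v; apply: image_law_ge0 => u; exact: law_ge0.
- by move=> y; rewrite image_law_mass law_sum1//; exact: mX.
Qed.

(** By stationarity each of the [n %/ L] slots inside [[0, n)] is free with the
  same probability. *)
Lemma free_slot_mean L n :
  \sum_y law P (window success 0 n) y *
    (\sum_(r < n %/ L) free_slot L [set k | y k] r)%:R =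
  (n %/ L)%:R * law P (window success 0 L) [ffun=> false].
Proof.
have [mY sY] := wY.
under eq_bigr do rewrite natr_sum mulr_sumr.
rewrite exchange_big/= mulr_natl -[in RHS](card_ord (n %/ L)) -sumr_const.
apply: eq_bigr => r _; rewrite -(sY (r * L)%N%:Z L).
under eq_bigr do rewrite mulr_natr mulrb.
rewrite -big_mkcond/=; apply: EFin_inj; rewrite -law_pred; last exact: mY.
rewrite EFin_law; last exact: mY.
have L0 : (0 < L)%N.
  have := ltn_ord r; move: (nat_of_ord r) => r'.
  by rewrite lt0n; apply: contraTneq => ->; rewrite divn0.
have rn : (r.+1 * L <= n)%N by rewrite -leq_divRL.
congr (P _); apply/seteqP; split=> t /=.
  move=> /forall_inP ht; apply/ffunP => i; rewrite !ffunE.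
  have kn : (r * L + i < n)%N by have := ltn_ord i; lia.
  apply/negbTE/negP => hi.
  have := ht (Ordinal kn); rewrite inE ffunE add0r PoszD hi => /(_ isT) /=.
  by rewrite divnMDl// (divn_small (ltn_ord i)) addn0 eqxx.
move=> /ffunP ht; apply/forall_inP => k; rewrite inE ffunE add0r; apply: contraL => /eqP kr.
have kL : (k - r * L < L)%N by rewrite -kr {1}(divn_eq k L) addKn ltn_pmod.
have := ht (Ordinal kL); rewrite !ffunE/= -PoszD subnKC => [->//|].
by rewrite -kr leq_trunc_div.
Qed.

End MaskedProcess.

(** * Comparison of the entropy rates *)

Lemma word_discrete (d : measure_display) (T : measurableType d) (R : realType)
    (X : int -> T -> R) n (v : n.-tuple R) : is_process X ->
  measurable (word X n @^-1` [set v]).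
Proof.
move=> mX; have -> : word X n @^-1` [set v] =
    [set t | forall k : 'I_n, xpredT k -> X k%:Z t = tnth v k].
  apply/seteqP; split=> t /= => [<- k _|tv]; first by rewrite tnth_mktuple.
  by apply: eq_from_tnth => k; rewrite tnth_mktuple tv.
apply: (sigma_gen_measurable (I := setT) mX).
exact: (@sigma_gen_cylinder _ _ X setT n (fun k => k%:Z)).
Qed.

Lemma word_finite (d : measure_display) (T : measurableType d) (R : realType)
    (S : finType) (X : int -> T -> R) (c : int -> T -> S) (dec : S -> R) n :
  coding X c dec -> finite_set (range (word X n)).
Proof.
move=> [_ Xd]; pose f (u : {ffun 'I_n -> S}) := [tuple dec (u k) | k < n].
apply: (@sub_finite_set _ _ (f @` setT)); last exact: finite_image.
move=> _ [t _ <-]; exists (window c 0 n t) => //.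
by apply: eq_from_tnth => k; rewrite !tnth_mktuple Xd ffunE add0r.
Qed.

Lemma entropy_rate_cvg (d : measure_display) (T : measurableType d) (R : realType)
    (P : probability T R) (S : finType) (Z : int -> T -> R) (c : int -> T -> S)
    (dec : S -> R) : coding Z c dec -> window_stationary P c ->
  (fun n => n%:R^-1 * law_entropy (law P (window c 0 n))) @ \oo --> entropy_rate P Z.
Proof.
move=> Zc wc; rewrite /entropy_rate.
under [X in _ --> limn X]eq_fun do rewrite (entropy_word P Zc).
exact: rate_cvg.
Qed.

Theorem corollary1p17 (d : measure_display) (T : measurableType d)
    (R : realType) (P : probability T R) (X Y : int -> T -> R) :
  good P X Y ->
  ergodic P Y ->
  entropy_rate P Y = 0 ->
  infinite_set
    [set k : nat | (0 < P [set w | return_time (sample_path Y w) 1%R = k%:Z])%E] ->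
  ~ bilaterally_deterministic P X ->
  entropy_rate P (mul_process X Y) < entropy_rate P X.
Proof.
move=> gXY _ hY inf /existsNP[l nl].
have mX := good_processX gXY; have mY := good_processY gXY.
have sX := good_stationaryX gXY; have sY := good_stationaryY gXY.
have [S [cX [decX Xc]]] := finitely_valued_coding (good_finiteX gXY).
have Yc := success_coding gXY; have Mc := mul_coding gXY Xc.
have wX := window_stationaryP Xc mX sX.
have wY := window_stationaryP Yc mY sY.
have wM := mul_window_stationary gXY Xc.
set L := l.+1 in nl; have L0 : (0 < L)%N by [].
have [v [D [e [und /eqP PD]]]] := cond_entropy_undecided
  (sigma_gen_measurable mX) (fun v => word_discrete v mX) (word_finite _ Xc) nl.
pose p0 := law P (window (success Y) 0 L) [ffun=> false].
have p00 : 0 < p0 by exact: (zero_run mY sY Yc).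
pose gap := e * fine (P D) / 2.
have gap0 : 0 < gap.
  have [e0 _ GD _] := und.
  rewrite divr_gt0// mulr_gt0// lt_neqAle fine_ge0// andbT eq_sym.
  by rewrite fine_eq0// fin_num_measure//; exact: (sigma_gen_measurable mX GD).
pose HX n := law_entropy (law P (window cX 0 n)).
pose HY n := law_entropy (law P (window (success Y) 0 n)).
pose HM n := law_entropy (law P (window (mul_code Y cX decX) 0 n)).
have main n : HM n + gap * ((n %/ L)%:R * p0) <= HY n + HX n.
  have [mcX _] := wX; have [mcY _] := wY.
  have s0 : S := cX 0 point.
  rewrite -(free_slot_mean gXY) mulr_sumr.
  apply: le_trans (lerD (mul_entropy_le gXY Xc s0 n) (lexx _)) _.
  rewrite -addrA lerD2l -big_split/=.
  have -> : HX n = \sum_y law P (window (success Y) 0 n) y * HX n.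
    by rewrite -mulr_suml law_sum1 ?mul1r//; exact: mcY.
  apply: ler_sum => y _; rewrite mulrCA -mulrDr ler_wpM2l ?law_ge0//.
  exact: (free_slots_gap s0 mX sX Xc L0 und).
(* The number of slots is at least [n / L - 1]. *)
have main' n : (0 < n)%N ->
    n%:R^-1 * HM n + (gap * p0) * (L%:R^-1 - n%:R^-1) <=
    n%:R^-1 * HY n + n%:R^-1 * HX n.
  move=> n0; rewrite -mulrDr; apply: le_trans (ler_wpM2l _ (main n)); last first.
    by rewrite invr_ge0 ler0n.
  rewrite [leRHS]mulrDr lerD2l.
  have nL : L%:R^-1 - n%:R^-1 <= n%:R^-1 * (n %/ L)%:R :> R.
    rewrite mulrC ler_pdivlMr ?ltr0n// mulrBl mulVf ?pnatr_eq0 -?lt0n//.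
    rewrite lerBlDr mulrC ler_pdivrMr ?ltr0n// natr1 -natrM ler_nat.
    exact/ltnW/ltn_ceil.
  have := ler_wpM2l (ltW (mulr_gt0 gap0 p00)) nL.
  by move=> /le_trans; apply; rewrite le_eqVlt; apply/orP; left; apply/eqP; ring.
suff : entropy_rate P (mul_process X Y) + (gap * p0) * (L%:R^-1 - 0) <=
    entropy_rate P Y + entropy_rate P X.
  have : 0 < (gap * p0) * L%:R^-1 :> R.
    by apply: mulr_gt0; [exact: mulr_gt0|rewrite invr_gt0 ltr0n].
  by rewrite hY subr0; lra.
apply: (@ler_cvg_to _ \oo _ _
  (fun n => n%:R^-1 * HM n + (gap * p0) * (L%:R^-1 - n%:R^-1))
  (fun n => n%:R^-1 * HY n + n%:R^-1 * HX n)).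
- apply: cvgD; first exact: (entropy_rate_cvg Mc wM).
  apply: cvgMr; apply: cvgB; first exact: cvg_cst.
  apply/(@gtr0_cvgV0 R nat \oo _ (fun n => n%:R)); last exact: cvgr_idn.
  by exists 1%N => // n /=; rewrite ltr0n.
- apply: cvgD; [exact: (entropy_rate_cvg Yc wY)|exact: (entropy_rate_cvg Xc wX)].
- by exists 1%N => // n /= n1; exact: main'.
Qed.
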